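(* Let $\alpha=\frac{1}{(\Delta+1)e}$ and let $p\in(0,1)$. For the Byzantine-tolerant algorithm described in the context, from any initial configuration, for every fair distributed daemon and every behaviour of the Byzantine nodes, with probability at least $1-p$ the execution reaches, within at most $$1+\max\left(-\alpha^{-2}\ln p,\ \frac{\sqrt{2}}{\sqrt{2}-1}\cdot\frac{n}{\alpha}\right)$$ rounds, a configuration $\gamma'$ in which $I_{\gamma'}$ is a maximal independent set of the subgraph of $G$ induced by $V_2\cup I_{\gamma'}$.
   Context: Network and model. $G=(V,E)$ is a finite simple undirected graph with $n=|V|$; $N(u)$ is the open neighbourhood of $u$, $N[u]=N(u)\cup\{u\}$, $\deg(u)=|N(u)|$, and $\Delta=\max_{u\in V}\deg(u)$. Nodes are anonymous (no identifiers). Each node holds local variables; a configuration is an assignment of values to all local variables of all nodes. An algorithm is a set of rules ''guard $\to$ command'', where the guard of a rule at node $u$ is a predicate on the variables of $u$ and its neighbours and the command may (possibly using randomness) rewrite only the variables of $u$. A rule is enabled on $u$ in configuration $\gamma$ if its guard holds there; $u$ is activable if some rule is enabled on it. A transition $\gamma\xrightarrow{t}\gamma'$ is given by a nonempty set $t$ of moves $(u,r)$ with $r$ enabled on $u$ in $\gamma$ and at most one move per node; all nodes of $t$ execute their commands simultaneously, reading the values in $\gamma$, with independent random choices. An execution is a sequence of consecutive transitions. The daemon chooses the set $t$ at each step (possibly depending on the whole past). The fair distributed daemon may choose any such $t$, subject only to fairness: no node may remain activable forever without being activated. Rounds. The rounds of an execution are consecutive segments of transitions: the first round starts at the beginning of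 the execution, each subsequent round starts immediately after the previous one ends, and the current round ends as soon as every node $u\in V$ has either been activated in at least one transition of the round or been non-activable in at least one configuration of the round. Byzantine nodes. A subset $B\subseteq V$ consists of Byzantine nodes: they are always activable and, when activated, may set their local variables to arbitrary values (adversarially). $d(u,B)$ is the graph distance from $u$ to $B$, and $V_i=\{u\in V: d(u,B)>i\}$ for $i\in\mathbb{N}$ (so $V_0=V\setminus B$). Probabilities are taken in the worst case over the daemon's and the Byzantine nodes' strategies. Algorithm. Each node $u$ has variables $s_u\in\{\bot,\top\}$ and $x_u\in\mathbb{N}$; $Rand(q)$ returns $1$ with probability $q$ and $0$ otherwise, independently. Non-Byzantine nodes follow the rules: (Refresh) $x_u\neq \deg(u)\ \to\ x_u:=\deg(u)$. (Candidacy?) $x_u=\deg(u)\wedge s_u=\bot\wedge \forall v\in N(u),\ s_v=\bot\ \to$ if $Rand\big(\frac{1}{1+\max\{x_v: v\in N[u]\}}\big)=1$ then $s_u:=\top$. (Withdrawal) $x_u=\deg(u)\wedge s_u=\top\wedge \exists v\in N(u),\ s_v=\top\ \to\ s_u:=\bot$. For a configuration $\gamma$ (with values $s_u^\gamma,x_u^\gamma$), $I_\gamma=\{u\in V_1: s_u^\gamma=\top \text{ and } \forall v\in N(u),\ s_v^\gamma=\bot\}$. *)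

(* Defs.v *)
From HB Require Import structures.
From mathcomp Require Import all_boot all_order all_algebra.
From mathcomp Require Import reals sequences exp.
Set Implicit Arguments.
Unset Strict Implicit.
Unset Printing Implicit Defensive.
Import Order.TTheory GRing.Theory Num.Theory.
Local Open Scope ring_scope.

(*  - a configuration gives each node u its pair (s_u, x_u), with      *)
(*    s_u = true meaning TOP and s_u = false meaning BOT;              *)
(*  - an adversary (daemon + Byzantine nodes, jointly) is a function   *)
(*    of the whole past (the sequence of configurations so far, the    *)
(*    last one being the current one) returning a set of nodes to      *)
(*    activate and the new values written by Byzantine nodes if        *)
(*    activated.  The requested set is intersected with the activable  *)
(*    nodes; if that is empty, all activable nodes are activated       *)
(*    (so every strategy denotes a legal daemon and every legal        *)
(*    daemon is denoted by some strategy).  If no node is activable    *)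
(*    the execution has ended (it then stutters, with no transitions). *)

Definition config (T : finType) := {ffun T -> bool * nat}.

Definition strategy (T : finType) :=
  seq (config T) -> {set T} * (T -> bool * nat).

Section Model.
Variable R : realType.
Variable T : finType.
Variable adj : rel T.
Variable B : {set T}.   (* Byzantine nodes *)

Definition sv (c : config T) u : bool := (c u).1.
Definition xv (c : config T) u : nat := (c u).2.

Definition nbhd (u : T) : {set T} := [set v | adj u v].
Definition deg (u : T) : nat := #|nbhd u|.
Definition maxdeg : nat := \max_(u : T) deg u.

Definition maxx (c : config T) (u : T) : nat :=
  \max_(v | (v == u) || adj u v) xv c v.

Definition refresh_en c u : bool := xv c u != deg u.
Definition cand_en c u : bool :=
  [&& xv c u == deg u, ~~ sv c u & [forall v, adj u v ==> ~~ sv c v]].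
Definition withdraw_en c u : bool :=
  [&& xv c u == deg u, sv c u & [exists v, adj u v && sv c v]].

Definition activable c u : bool :=
  (u \in B) || [|| refresh_en c u, cand_en c u | withdraw_en c u].

Definition activable_set c : {set T} := [set u | activable c u].

Definition cur (h : seq (config T)) : config T := last [ffun=> (false, 0%N)] h.

Definition act (st : strategy T) (h : seq (config T)) : {set T} :=
  let A := activable_set (cur h) in
  let t := (st h).1 :&: A in
  if t == set0 then A else t.

Definition qprob (c : config T) (u : T) : R := 1 / (1 + (maxx c u)%:R).

Definition cand_set st h : {set T} :=
  [set u in act st h | (u \notin B) && cand_en (cur h) u].

Definition next (st : strategy T) (h : seq (config T)) (coin : {ffun T -> bool})
  : config T :=
  let c := cur h in
  [ffun u =>
     if u \in act st h then
       if u \in B then (st h).2 u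
       else if refresh_en c u then (sv c u, deg u)
       else if cand_en c u then (coin u, xv c u)
       else if withdraw_en c u then (false, xv c u)
       else c u
     else c u].

Definition weight st h (coin : {ffun T -> bool}) : R :=
  \prod_(u : T)
    (if u \in cand_set st h then (if coin u then qprob (cur h) u else 1 - qprob (cur h) u)
     else (if coin u then 0 else 1)).

Fixpoint prob (st : strategy T) (k : nat) (E : pred (seq (config T)))
   (h : seq (config T)) : R :=
  if k is k'.+1 then
    \sum_(coin : {ffun T -> bool}) weight st h coin * prob st k' E (rcons h (next st h coin))
  else (if E h then 1 else 0).

Definition hist (c : nat -> config T) (i : nat) : seq (config T) :=
  [seq c k | k <- iota 0 i.+1].

Definition possible_exec (st : strategy T) (c0 : config T) (c : nat -> config T) : Prop :=
  c 0%N = c0 /\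
  forall i, exists coin, 0 < weight st (hist c i) coin /\
                         c i.+1 = next st (hist c i) coin.

Definition fair_exec (st : strategy T) (c : nat -> config T) : Prop :=
  forall u, ~ (exists N, forall i, (N <= i)%N ->
                 activable (c i) u /\ u \notin act st (hist c i)).

Definition fair_strategy (st : strategy T) (c0 : config T) : Prop :=
  forall c, possible_exec st c0 c -> fair_exec st c.

(* Rounds.  For a history h = c_0 .. c_m (transition i goes from c_i to
   c_{i+1} activating act st (take i.+1 h)), rstate i = (number of rounds
   that ended at a configuration of index <= i, set of nodes already
   activated or seen non-activable in the current round). *)
Fixpoint rstate (st : strategy T) (h : seq (config T)) (i : nat) : nat * {set T} :=
  let c0 := [ffun=> (false, 0%N)] in
  if i is i'.+1 then
    let: (r, cov) := rstate st h i' in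
    let ci := nth c0 h i in
    let cov' := cov :|: act st (take i h) :|: ~: activable_set ci in
    if cov' == setT then (r.+1, ~: activable_set ci) else (r, cov')
  else (0%N, ~: activable_set (nth c0 h 0)).

Definition rounds_before st h (j : nat) : nat := (rstate st h j.-1).1.

(* distance to B: near i = { u | d(u,B) <= i };  V_i = complement *)
Fixpoint near (i : nat) : {set T} :=
  if i is i'.+1 then near i' :|: [set u | [exists v, adj u v && (v \in near i')]]
  else B.
Definition Vset (i : nat) : {set T} := ~: near i.

Definition Iset (c : config T) : {set T} :=
  [set u in Vset 1 | sv c u && [forall v, adj u v ==> ~~ sv c v]].

Definition independent (I : {set T}) : bool :=
  [forall u in I, forall v in I, ~~ adj u v].

Definition mis_of (S I : {set T}) : bool :=
  [&& I \subset S, independent I &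
   [forall J : {set T}, (I \proper J) && (J \subset S) ==> ~~ independent J]].

Definition good (c : config T) : bool := mis_of (Vset 2 :|: Iset c) (Iset c).

(* the history contains, within the first K rounds, a good configuration
   (K real: the configuration lies in round number <= K) *)
Definition reached_within (st : strategy T) (K : R) (h : seq (config T)) : bool :=
  [exists j : 'I_(size h),
     good (nth [ffun=> (false, 0%N)] h j) &&
     ((rounds_before st h j).+1%:R <= K)].

Definition alpha : R := 1 / ((maxdeg.+1)%:R * expR 1).

Definition round_bound (p : R) : R :=
  1 + Num.max (- (alpha ^-2) * ln p)
              (Num.sqrt 2 / (Num.sqrt 2 - 1) * (#|T|%:R / alpha)).

End Model.

(* Main.v *)
Require Import Defs.
From mathcomp Require Import all_boot all_order all_algebra.
From mathcomp Require Import boolp reals sequences exp.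
From mathcomp Require Import ring lra.
Import Order.TTheory GRing.Theory Num.Theory.
Local Open Scope ring_scope.

(* The set I never shrinks, and after the first round x_u = deg u for all correct
   nodes. If the configuration is not good, some w in V_2 is neither in I nor
   adjacent to I. A round that starts with N[w] entirely BOT makes some vertex of
   N[w] TOP with probability at least 1/(Delta+1). Otherwise all TOP vertices of
   N[w] are in conflict, and during the round either they all withdraw, leaving
   N[w] BOT at its end, or a vertex of N[w] runs Candidacy. Whenever simultaneous
   candidacies produce a TOP vertex in N[w], with conditional probability at least
   1/e one of these is isolated, so that I grows.

   A single round can thus be wasted on withdrawals, and I need not grow with
   probability alpha in each round. The count is instead made with
   the potential exp (n - 1 - #|I|) * g ^ (rounds ended) * stage, where stage in
   {1, g, g^2} charges for the withdrawals still due; g is chosen so that this is a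
   supermartingale. Markov's inequality bounds the probability of failure after
   1 + M rounds by p. *)

(** * Isolated successes among independent coins *)

Section Bernoulli.
Context {R : realFieldType} {T : finType}.
Variable p : T -> R.
Hypothesis p01 : forall u, 0 <= p u <= 1.

Definition bern (coin : {ffun T -> bool}) : R :=
  \prod_u (if coin u then p u else 1 - p u).

Definition Pr (E : pred {ffun T -> bool}) : R :=
  \sum_coin bern coin * (E coin)%:R.

Definition none_on (Z : {set T}) (coin : {ffun T -> bool}) :=
  [forall u in Z, ~~ coin u].

Lemma bern_ge0 coin : 0 <= bern coin.
Proof.
by apply: prodr_ge0 => u _; have /andP[] := p01 u; case: ifP; rewrite ?subr_ge0.
Qed.

Lemma bern_sum1 : \sum_coin bern coin = 1.
Proof.
rewrite -(bigA_distr_bigA (fun u b => if b then p u else 1 - p u)) /=.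
by rewrite big1 // => u _; rewrite big_bool /= addrC subrK.
Qed.

Lemma eq_Pr E F : E =1 F -> Pr E = Pr F.
Proof. by move=> eqEF; apply: eq_bigr => c _; rewrite eqEF. Qed.

Lemma le_Pr (E F : pred {ffun T -> bool}) : (forall c, E c -> F c) -> Pr E <= Pr F.
Proof.
move=> EF; apply: ler_sum => c _; rewrite ler_wpM2l ?bern_ge0 // ler_nat.
by case: (E c) (EF c) => [->|].
Qed.

Lemma Pr_ge0 E : 0 <= Pr E.
Proof. by apply: sumr_ge0 => c _; rewrite mulr_ge0 ?bern_ge0 ?ler0n. Qed.

Lemma Pr_le1 E : Pr E <= 1.
Proof.
rewrite -bern_sum1; apply: ler_sum => c _.
by rewrite ler_piMr ?bern_ge0 // lern1; case: (E c).
Qed.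

Lemma Pr_none_on_true (Z : {set T}) v : v \notin Z ->
  Pr (fun c => c v && none_on Z c) = p v * \prod_(u in Z) (1 - p u).
Proof.
(* The indicator of the event is a product of one-coordinate indicators, so the sum over coins
   factors. *)
move=> vZ; pose F u (b : bool) : R :=
  (if b then p u else 1 - p u) *
  (((u == v) ==> b) && ((u \in Z) ==> ~~ b))%:R.
transitivity (\sum_(c : {ffun T -> bool}) \prod_u F u (c u)).
  apply: eq_bigr => c _; rewrite big_split /=; congr (_ * _).
  case: (boolP (_ && _)) => [/andP[cv /forallP cZ]|/nandP[cv|]].
  - rewrite big1 // => u _; rewrite cZ andbT.
    by case: eqP => // ->; rewrite cv.
  - by rewrite (bigD1 v) //= eqxx (negbTE cv) mul0r.
  - by case/forallPn=> u cu; rewrite (bigD1 u) //= (negbTE cu) andbF mul0r.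
rewrite -bigA_distr_bigA /= (bigD1 v) //=; congr (_ * _).
  by rewrite big_bool /F /= eqxx (negbTE vZ) /= mulr1 mulr0 addr0.
rewrite [RHS](big_mkcond (fun u => u \in Z)) /= [RHS](bigD1 v) //= (negbTE vZ) mul1r.
apply: eq_bigr => u uv; rewrite big_bool /F /= (negbTE uv) /=.
by case: (u \in Z); rewrite /= ?mulr0 ?mulr1 ?add0r // addrC subrK.
Qed.

Lemma Pr_true v : Pr (fun c => c v) = p v.
Proof.
have /(Pr_none_on_true set0) : v \notin (set0 : {set T}) by rewrite inE.
rewrite big_set0 mulr1 => <-; apply: eq_Pr => c.
by rewrite (_ : none_on _ c) ?andbT //; apply/forallP=> u; rewrite inE.
Qed.

Lemma none_onU1 v (Z : {set T}) c : none_on (v |: Z) c = ~~ c v && none_on Z c.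
Proof.
apply/forall_inP/andP => [H|[cv /forall_inP cZ] u].
  split; first by apply: H; rewrite setU11.
  by apply/forall_inP=> u uZ; apply: H; rewrite setU1r.
by rewrite !inE => /orP[/eqP->|/cZ].
Qed.

Lemma none_onU (Y Z : {set T}) c : none_on (Y :|: Z) c = none_on Y c && none_on Z c.
Proof.
apply/forall_inP/andP => [H|[/forall_inP cY /forall_inP cZ] u].
  by split; apply/forall_inP=> u uZ; apply: H; rewrite inE uZ ?orbT.
by rewrite !inE => /orP[/cY|/cZ].
Qed.

Lemma Pr_split (E F : pred {ffun T -> bool}) :
  Pr E = Pr (fun c => F c && E c) + Pr (fun c => ~~ F c && E c).
Proof.
rewrite -big_split /=; apply: eq_bigr => c _; rewrite -mulrDr.
by case: (F c) => /=; rewrite ?addr0 ?add0r.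
Qed.

(* Reveal the coins of S one by one and stop at the first success v: the
   coins of N v seen so far are off, and the remaining ones are independent. *)
Lemma Pr_isolated_list (N : T -> {set T}) (r : R) (s : seq T) (Z : {set T}) :
  0 <= r ->
  (forall v, v \in s -> v \notin N v /\ r <= \prod_(u in N v) (1 - p u)) ->
  r * Pr (fun c => none_on Z c && has (fun v => c v) s) <=
  Pr (fun c => none_on Z c && has (fun v => c v && none_on (N v) c) s).
Proof.
move=> r0; elim: s Z => [|v s IHs] Z Hs.
  rewrite (_ : Pr _ = 0) ?mulr0 ?Pr_ge0 //.
  by rewrite /Pr big1 // => c _; rewrite /= andbF mulr0.
have [vN rN] := Hs v (mem_head _ _).
rewrite (Pr_split _ (fun c => c v)) mulrDr.
(* If the coin of [v] is off, [v] joins [Z] and induction applies. If it is on, a success is certain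
   and it suffices that [v] itself be isolated. *)
rewrite [leRHS](Pr_split _ (fun c => c v)); apply: lerD; last first.
  have cE (F : pred {ffun T -> bool}) : Pr (fun c => none_on (v |: Z) c && F c) =
      Pr (fun c => ~~ c v && (none_on Z c && F c)).
    by apply: eq_Pr => c /=; rewrite none_onU1 andbA.
  have := IHs (v |: Z); rewrite !cE.
  rewrite (@eq_Pr _ (fun c => ~~ c v && (none_on Z c && has (fun v => c v) (v :: s)))); last first.
    by move=> c /=; case: (c v).
  rewrite (@eq_Pr (fun c => ~~ c v && (none_on Z c && has _ s))
    (fun c => ~~ c v && (none_on Z c && has (fun v => c v && none_on (N v) c) (v :: s)))); last first.
    by move=> c /=; case: (c v).
  by apply=> u us; apply: Hs; rewrite inE us orbT.
rewrite (@eq_Pr _ (fun c => c v && none_on Z c)); last first.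
  by move=> c /=; case: (c v); rewrite ?andbT.
apply: (@le_trans _ _ (Pr (fun c => c v && none_on (Z :|: N v) c))); last first.
  apply: le_Pr => c; rewrite none_onU /= => /and3P[-> -> ->] //.
have [vZ|vZ] := boolP (v \in Z).
  rewrite (_ : Pr _ = 0) ?mulr0 ?Pr_ge0 // /Pr big1 // => c _.
  case: (boolP (_ && _)); rewrite ?mulr0 // => /andP[cv /forall_inP/(_ _ vZ)].
  by rewrite cv.
rewrite !Pr_none_on_true ?inE ?negb_or ?vZ //.
have /andP[pv0 _] := p01 v; rewrite mulrCA ler_wpM2l //.
have q0 u : 0 <= 1 - p u by rewrite subr_ge0; have /andP[] := p01 u.
have q1 u : 1 - p u <= 1 by rewrite gerBl; have /andP[] := p01 u.
(* The coins of [Z] are already counted; those of [N v] outside [Z] contribute a factor at least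
   [r]. *)
rewrite [leRHS](eq_bigl (fun u => u \in Z :|: (N v :\: Z))); last first.
  by move=> u; rewrite !inE; case: (u \in Z).
rewrite [leRHS](eq_bigl [predU Z & N v :\: Z]); last by move=> u; rewrite !inE.
rewrite [leRHS]bigU /=; last first.
  by rewrite disjoint_subset; apply/subsetP=> u; rewrite !inE => ->.
rewrite mulrC ler_wpM2l ?prodr_ge0 //; apply: (le_trans rN).
rewrite (big_setID Z) /= ler_piMl ?prodr_ge0 //.
by apply: prodr_ile1 => u _; rewrite q0 q1.
Qed.

Lemma Pr_isolated (N : T -> {set T}) (r : R) (S : {set T}) :
  0 <= r ->
  (forall v, v \in S -> v \notin N v /\ r <= \prod_(u in N v) (1 - p u)) ->
  r * Pr (fun c => [exists v in S, c v]) <=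
  Pr (fun c => [exists v in S, c v && none_on (N v) c]).
Proof.
move=> r0 HS; have := @Pr_isolated_list N r (enum S) set0 r0.
have n0 c : none_on set0 c by apply/forallP=> u; rewrite inE.
have hasE (F : pred T) : has F (enum S) = [exists v in S, F v].
  apply/hasP/exists_inP => [[v vS Fv]|[v vS Fv]]; exists v => //.
    by rewrite mem_enum in vS.
  by rewrite mem_enum.
have cE (F : {ffun T -> bool} -> pred T) :
    Pr (fun c => none_on set0 c && has (F c) (enum S)) = Pr (fun c => [exists v in S, F c v]).
  by apply: eq_Pr => c /=; rewrite n0 hasE.
rewrite !cE.
by apply=> v; rewrite mem_enum => /HS.
Qed.

(** Pointwise, $f\le a+1_E(b-a)-1_S(b-d)$; integrate, then use the lower bound on the probability of
    [S]. *)
Lemma bern_expect_le (f : {ffun T -> bool} -> R) (E S : pred {ffun T -> bool}) (r a b d : R) :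
  (forall c, S c -> E c) -> r * Pr E <= Pr S -> d <= b ->
  (forall c, S c -> f c <= d) ->
  (forall c, E c -> f c <= b) ->
  (forall c, ~~ E c -> f c <= a) ->
  \sum_c bern c * f c <= (1 - Pr E) * a + Pr E * (b - r * (b - d)).
Proof.
move=> SE rE db fd fb fa.
have -> : (1 - Pr E) * a + Pr E * (b - r * (b - d)) =
  a + Pr E * (b - a) - r * Pr E * (b - d) by ring.
apply: (@le_trans _ _ (a + Pr E * (b - a) - Pr S * (b - d))); last first.
  by rewrite lerD2l lerN2 ler_wpM2r // subr_ge0.
rewrite -[a]mul1r -{1}bern_sum1 mulr_suml mulr_suml mulr_suml -sumrN -!big_split /=.
apply: ler_sum => c _; rewrite mul1r -!mulrA -mulrN -!mulrDr ler_wpM2l ?bern_ge0 //.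
case: (boolP (S c)) => [Sc|_].
  by rewrite (SE _ Sc) !mul1r; have := fd _ Sc; lra.
case: (boolP (E c)) => [/fb|/fa]; rewrite ?mul1r ?mul0r; lra.
Qed.

End Bernoulli.

(** * Constants of the potential *)

Section Constants.
Context {R : realType}.

Definition inve : R := (expR 1)^-1.

Lemma inve_gt0 : 0 < inve. Proof. by rewrite invr_gt0 expR_gt0. Qed.

(** Both bounds come from $1+x\le e^x$: at $x=-1/2$ it gives $e\le 4$, at $x=1/4$ it gives
    $e\ge(5/4)^4$. *)
Lemma inve_bounds : 1/4 <= inve <= 256/625.
Proof.
have e0 := expR_gt0 (1 : R).
have h2 : expR (1/2) * expR (1/2) = expR 1 :> R by rewrite -expRD; congr expR; lra.
have hm : 1/2 * expR (1/2) <= 1 :> R.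
  rewrite -[leRHS](expRxMexpNx_1 (1/2)) mulrC ler_wpM2l ?expR_ge0 //.
  by have := expR_ge1Dx (- (1/2) : R); lra.
have h4 : expR (1/4) ^+ 4 = expR 1 :> R by rewrite -expRM_natl; congr expR; lra.
have hq : (5/4) ^+ 4 <= expR 1 :> R.
  by rewrite -h4 lerXn2r ?nnegrE ?expR_ge0 //; [lra|have := expR_ge1Dx (1/4 : R); lra].
have e4 : expR 1 <= 4 :> R by have := expR_ge0 (1/2 : R); nra.
apply/andP; split.
  by rewrite -[1/4]invrK lef_pV2 ?posrE //; lra.
by rewrite -[256/625]invrK /inve lef_pV2 ?posrE //; lra.
Qed.

Variable D : nat.

Definition coin_min : R := (D.+1)%:R^-1.
(** This is $\alpha$ when [D] is $\Delta$. *)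
Definition rate : R := coin_min * inve.
(* theta is the exponential rate at which the potential decays per round; it has
   to beat rate ^+ 2 + (1 - 1 / sqrt 2) * rate, see final_bound. *)
Definition theta : R := rate ^+ 2 + 3/10 * rate.
Definition growth : R := expR theta.

(* A lower bound for (1 - 1/(d+1))^d, d <= D, hence for the probability that a
   node which becomes TOP has no TOP neighbour. For D <= 1 the bound 1/e is too
   weak for the numerical estimates below. *)
Definition iso_prob : R := if D is D'.+1 then if D' is _.+1 then inve else 1/2 else 1.
(** Mean of a variable equal to $1/e$ with probability [iso_prob] and to 1 otherwise: the expected
    factor on [deficit] once a candidacy near [w] has succeeded. *)
Definition fail_factor : R := 1 - iso_prob * (1 - inve).

Lemma coin_min_gt0 : 0 < coin_min.
Proof. by rewrite invr_gt0 ltr0n. Qed.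

Lemma coin_min_le1 : coin_min <= 1.
Proof. by rewrite invf_le1 ?ltr0n // ler1n. Qed.

Lemma iso_prob01 : 0 <= iso_prob <= 1.
Proof.
have /andP[y0 y1] := inve_bounds.
by rewrite /iso_prob; case: D => [|[|d]]; apply/andP; split; lra.
Qed.

Lemma inve_le_fail_factor : inve <= fail_factor.
Proof.
have /andP[r0 r1] := iso_prob01; have /andP[y0 y1] := inve_bounds.
rewrite /fail_factor; nra.
Qed.

Lemma rate_gt0 : 0 < rate.
Proof. by rewrite mulr_gt0 ?coin_min_gt0 ?inve_gt0. Qed.

Lemma rate_le : rate <= 256/625.
Proof.
have /andP[y0 y1] := inve_bounds; rewrite /rate.
have := coin_min_le1; have := coin_min_gt0; nra.
Qed.

Lemma theta_gt0 : 0 < theta.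
Proof. by have := rate_gt0; rewrite /theta; nra. Qed.

Lemma theta_le_half : theta <= 1/2.
Proof. by have := rate_gt0; have := rate_le; rewrite /theta; nra. Qed.

Lemma growth_ge1 : 1 <= growth.
Proof. by rewrite -expR0 ler_expR ltW ?theta_gt0. Qed.

Lemma growth_gt0 : 0 < growth. Proof. exact: expR_gt0. Qed.

Lemma growth_ge0 : 0 <= growth. Proof. exact: expR_ge0. Qed.

Lemma growth_mul_le1 : growth * (1 - theta) <= 1.
Proof.
rewrite -[leRHS](expRxMexpNx_1 theta) ler_wpM2l ?expR_ge0 //.
by have := expR_ge1Dx (- theta); lra.
Qed.

(* theta / coin_min is written inve * (rate + 3/10) *)
Lemma fail_factor_le :
  fail_factor <= (1 - theta) * (1 - inve * (rate + 3/10)).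
Proof.
have /andP[] := inve_bounds; rewrite /fail_factor /theta /rate /iso_prob /coin_min.
move: inve => y y0 y1; case: D => [|[|d]].
- by rewrite invr1; nra.
- nra.
(* For $D\ge 2$ the left side is $1-y+y^2$. The right side decreases in $a=qy\le y/3$, so it
   suffices to treat $a=y/3$, a polynomial inequality in $y$. *)
have : (0 < (d.+3)%:R^-1 :> R) && ((d.+3)%:R^-1 <= 1/3 :> R).
  have d3 : (3 : R) <= d.+3%:R by rewrite ler_nat.
  apply/andP; split; first by rewrite invr_gt0; lra.
  by rewrite -div1r ler_pdivrMr; lra.
move: (d.+3)%:R^-1 => q /andP[q0 q3].
have a1 : q * y <= y / 3 by nra.
have a0 : 0 <= q * y by nra.
move: (q * y) a0 a1 => a a0 a1.
have t1 : a ^+ 2 + 3/10 * a <= y / 3 * (y / 3 + 3/10) by nra.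
have t0 : 0 <= a ^+ 2 + 3/10 * a by nra.
have s1 : y * (a + 3/10) <= y * (y / 3 + 3/10) by nra.
have s0 : 0 <= y * (a + 3/10) by nra.
apply: (@le_trans _ _ ((1 - y / 3 * (y / 3 + 3/10)) * (1 - y * (y / 3 + 3/10)))).
  have p0 : 0 <= y by lra.
  have p1 : 0 <= y * (256/625 - y) by rewrite mulr_ge0 // subr_ge0.
  have p3 : 0 <= y ^+ 3 by rewrite exprn_ge0.
  have p4 : 0 <= y ^+ 4 by rewrite exprn_ge0.
  nra.
by apply: ler_pM; nra.
Qed.

Lemma growth_fail_le : growth * fail_factor <= 1 - inve * (rate + 3/10).
Proof.
have := fail_factor_le; have := growth_mul_le1; have := growth_gt0.
have /andP[y0 y1] := inve_bounds; have := rate_gt0; have := rate_le.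
move: growth fail_factor theta rate inve y0 y1 => g b t a y y0 y1 a1 a0 g0 gt bt.
have z0 : 0 <= 1 - y * (a + 3/10) by nra.
apply: (@le_trans _ _ (g * ((1 - t) * (1 - y * (a + 3/10))))).
  by rewrite ler_wpM2l // ltW.
by rewrite mulrA ler_piMl.
Qed.

Lemma growth_fail_le1 : growth * fail_factor <= 1.
Proof.
have := growth_fail_le; have /andP[y0 _] := inve_bounds; have := rate_gt0; nra.
Qed.

Lemma thetaE : theta = coin_min * (inve * (rate + 3/10)).
Proof. by rewrite /theta /rate; ring. Qed.

(** Even if a successful candidacy throws the stage back from 1 to $g^2$, the expected drop of
    [deficit] pays for it. *)
Lemma growth2_fail_le1 : growth * (growth * fail_factor) <= 1.
Proof.
apply: le_trans growth_mul_le1; rewrite ler_wpM2l ?growth_ge0 //.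
apply: (le_trans growth_fail_le); rewrite lerD2l lerN2 thetaE.
rewrite ler_piMl ?coin_min_le1 // mulr_ge0 ?(ltW inve_gt0) //.
by have := rate_gt0; lra.
Qed.

(** The left side is affine and nonincreasing in [t], so the worst case is [t = coin_min], where the
    bracket is at most $1-\theta$. *)
Lemma growth_step_le1 t : coin_min <= t -> 
  growth * ((1 - t) + t * (growth * fail_factor)) <= 1.
Proof.
move=> qt; apply: le_trans growth_mul_le1; rewrite ler_wpM2l ?growth_ge0 //.
have := growth_fail_le; have := growth_fail_le1; rewrite thetaE.
have := coin_min_gt0; move: coin_min (growth * _) (inve * _) qt => q s z; nra.
Qed.

(** In the general case $(1-1/(d+1))^d=(1+1/d)^{-d}\ge 1/e$, because $1+1/d\le e^{1/d}$; for [D] at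
    most 1 the values are explicit. *)
Lemma iso_prob_le d : (d <= D)%N -> iso_prob <= (1 - (d.+1)%:R^-1) ^+ d.
Proof.
rewrite /iso_prob; case: D => [|[|d']].
- by case: d => // _; rewrite expr0.
- by case: d => [|[|]] // _; rewrite ?expr0 ?expr1; lra.
move=> _; case: d => [|d]; first by rewrite expr0; have /andP[] := inve_bounds; lra.
have d0 : 0 < (d.+1)%:R :> R by rewrite ltr0n.
have -> : 1 - (d.+2)%:R^-1 = (1 + (d.+1)%:R^-1)^-1 :> R.
  rewrite -[in (d.+2)%:R]addn1 natrD; move: (d.+1)%:R d0 => x x0.
  field; rewrite !lt0r_neq0 //; lra.
have pos : 0 < 1 + (d.+1)%:R^-1 :> R by rewrite ltr_wpDr // invr_ge0 ltW.
rewrite exprVn lef_pV2 ?posrE ?exprn_gt0 ?expR_gt0 //.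
rewrite -[X in expR X](@mulfV _ (d.+1)%:R) ?lt0r_neq0 // expRM_natl.
by rewrite lerXn2r ?nnegrE ?expR_ge0 ?(ltW pos) // expR_ge1Dx.
Qed.

(** In logarithms, and since $N+1>M$: the part [rate ^+ 2] of [theta] pays for $-\ln p$, the part
    [3/10 * rate] pays for $n$. *)
Lemma final_bound (n : nat) (p M : R) (N := Num.truncn M) :
  0 < p ->
  - (rate ^- 2) * ln p <= M ->
  Num.sqrt 2 / (Num.sqrt 2 - 1) * (n%:R / rate) <= M ->
  expR (n%:R - 1) * growth ^+ 2 <= p * growth ^+ N.+1.
Proof.
move=> p0 M1 M2.
have a0 := rate_gt0.
have MN : M < N.+1%:R.
  by have := truncn_le_nat M N; rewrite /N leqnn => <-.
have lnp : - (rate ^+ 2 * M) <= ln p.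
  have := ler_wpM2l (ltW (exprn_gt0 2 a0)) M1.
  rewrite mulNr mulrN mulrA mulfV ?mul1r ?expf_neq0 ?lt0r_neq0 //.
  by rewrite lerNl.
have nM : n%:R <= 3/10 * (rate * M).
  have s0 : 0 <= Num.sqrt 2 :> R by exact: sqrtr_ge0.
  have s2 : Num.sqrt 2 ^+ 2 = 2 :> R by rewrite sqr_sqrtr.
  move: (Num.sqrt 2) s0 s2 M2 => s s0 s2 M2.
  have s1 : 0 < s - 1 by nra.
  (* Here $\sqrt2/(\sqrt2-1)=2+\sqrt2>10/3$; this is what allows the coefficient 3/10 in [theta]. *)
  have k : 10/3 <= s / (s - 1) by rewrite ler_pdivlMr //; nra.
  have n0 : 0 <= n%:R / rate by rewrite divr_ge0 // ltW.
  have -> : n%:R = rate * (n%:R / rate) by field; rewrite lt0r_neq0.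
  move: (n%:R / rate) n0 M2 => z z0 zM.
  have zM' : z <= 3/10 * M by have := ler_wpM2r z0 k; lra.
  by rewrite mulrCA ler_wpM2l // ltW.
rewrite -{1}(lnK p0) -expRM_natl -expRD -expRM_natl -expRD ler_expR.
(* The initial factor $g^2=e^{2\theta}$ is absorbed by the $-1$ in the exponent, as $2\theta\le
   1$. *)
apply: (@le_trans _ _ (n%:R)); first by have := theta_le_half; lra.
apply: (@le_trans _ _ (- (rate ^+ 2 * M) + M * theta)); first by rewrite /theta; nra.
by rewrite lerD // ler_wpM2r // ltW // theta_gt0.
Qed.

End Constants.

(** * One transition of the algorithm *)

Section Dynamics.
Context {T : finType} (adj : rel T) (B : {set T}).
Hypothesis adj_sym : symmetric adj.
Variable st : strategy T.

Local Notation deg := (deg adj).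
Local Notation Iset := (Iset adj B).
Local Notation activable := (activable adj B).
Local Notation activable_set := (activable_set adj B).
Local Notation V := (Vset adj B).

Definition cnbhd (w v : T) : bool := (v == w) || adj w v.

Definition degrees_ok (c : config T) := forall u, u \notin B -> xv c u = deg u.

Lemma Vset_step i w v : w \in V i.+1 -> cnbhd w v -> v \in V i.
Proof.
rewrite !inE negb_or => /andP[wi /existsPn wn] /orP[/eqP->|wv] //.
by have := wn v; rewrite wv.
Qed.

Lemma cnbhdxx w : cnbhd w w. Proof. by rewrite /cnbhd eqxx. Qed.

Lemma Vset1_notin v u : v \in V 1 -> cnbhd v u -> u \notin B.
Proof. by move=> v1 vu; have := Vset_step 0 _ _ v1 vu; rewrite inE. Qed.

Lemma Vset2_notin w v : w \in V 2 -> cnbhd w v -> v \notin B.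
Proof. by move=> w2 wv; apply: Vset1_notin (Vset_step _ _ _ w2 wv) (cnbhdxx v). Qed.

Lemma not_activable_deg c u : u \notin B -> ~~ activable c u -> xv c u = deg u.
Proof. by rewrite /Defs.activable => /negbTE->; rewrite /= !negb_or negbK => /and3P[/eqP]. Qed.

Lemma notin_cover c (cov A : {set T}) v :
  (v \notin cov :|: A :|: ~: activable_set c) = [&& v \notin cov, v \notin A & activable c v].
Proof.
rewrite !in_setU in_setC [v \in activable_set c]inE.
by case: (v \in cov); case: (v \in A); case: (activable c v).
Qed.

Section Step.
Variable h : seq (config T).
Variable coin : {ffun T -> bool}.
Let c := cur h.
Let c' := Defs.next adj B st h coin.
Local Notation actv := (act adj B st h).
Local Notation cands := (cand_set adj B st h).

Lemma next_deg u : u \notin B -> xv c u = deg u -> xv c' u = deg u.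
Proof.
move=> uB xu; rewrite /c' /Defs.next /xv ffunE (negbTE uB) /refresh_en.
by rewrite -/c xu eqxx /=; do !case: ifP.
Qed.

Lemma act_deg u : u \notin B -> u \in actv -> xv c' u = deg u.
Proof.
move=> uB ua; rewrite /c' /Defs.next /xv ffunE ua (negbTE uB) /refresh_en.
by rewrite -/c; case: ifPn => //; rewrite negbK => /eqP xu; do !case: ifP.
Qed.

Lemma next_degrees_ok : degrees_ok c -> degrees_ok c'.
Proof. by move=> ok u uB; apply: next_deg => //; apply: ok. Qed.

Lemma cand_next u : u \in cands -> sv c' u = coin u.
Proof.
rewrite inE => /and3P[ua uB uc]; rewrite /c' /Defs.next /sv ffunE ua (negbTE uB) uc.
by case/and3P: (uc) => xu _ _; rewrite /refresh_en xu.
Qed.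

Lemma next_sv u : u \notin B -> sv c' u -> sv c u \/ u \in cands /\ coin u.
Proof.
move=> uB; case: (boolP (u \in cands)) => [uc|].
  by rewrite cand_next //; right.
rewrite inE uB /= /c' /Defs.next /sv ffunE (negbTE uB) => uc.
case: ifP uc => [_ /=|_ _]; last by left.
by move/negbTE->; case: ifP; [left|case: ifP => //; left].
Qed.

Lemma next_withdraw u : u \notin B -> withdraw_en adj c u -> u \in actv -> ~~ sv c' u.
Proof.
move=> uB uw ua; case/and3P: (uw) => xu su _.
rewrite /c' /Defs.next /sv ffunE ua (negbTE uB) /refresh_en xu /=.
by rewrite /cand_en su andbF -/c uw.
Qed.

Lemma next_stable u : u \notin B -> sv c u -> [forall v, adj u v ==> ~~ sv c v] -> sv c' u.
Proof.
move=> uB su /forallP sn; rewrite /c' /Defs.next /sv ffunE (negbTE uB) -/c.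
case: ifP => // _; case: ifP => // _; rewrite /cand_en su andbF /=.
case: ifP => // /and3P[_ _ /existsP[v /andP[uv sv']]].
by have := sn v; rewrite uv sv'.
Qed.

(** A member of I lies in [V 1], so it and its neighbours are correct: it has no reason to withdraw,
    and its neighbours see a TOP vertex and cannot run Candidacy. *)
Lemma Iset_next_sub : Iset c \subset Iset c'.
Proof.
apply/subsetP=> u; rewrite inE => /and3P[uV1 su sn].
have uB := Vset1_notin _ _ uV1 (cnbhdxx u).
rewrite inE uV1 next_stable //=; apply/forallP=> v; apply/implyP=> uv.
have vB : v \notin B by apply: Vset1_notin uV1 _; rewrite /cnbhd uv orbT.
apply/negP=> /(next_sv _ vB) [sv'|[]].
  by move/forallP/(_ v): sn; rewrite uv sv'.
rewrite inE => /and3P[_ _ /and3P[_ _ /forallP/(_ u)]].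
by rewrite adj_sym uv su.
Qed.

(** A candidate is BOT, hence outside I, and so are all its neighbours BOT; only a simultaneous
    successful candidacy could make one of them TOP. *)
Lemma Iset_next_isolated v : v \in V 1 -> v \in cands -> coin v ->
  (forall u, adj v u -> u \in cands -> ~~ coin u) -> Iset c \proper Iset c'.
Proof.
move=> v1 vc cv cn; rewrite properE Iset_next_sub; apply/subsetPn; exists v.
  rewrite inE v1 cand_next // cv /=; apply/forallP=> u; apply/implyP=> vu.
  have uB : u \notin B by apply: Vset1_notin v1 _; rewrite /cnbhd vu orbT.
  apply/negP=> /(next_sv _ uB) [su|[uc]].
    move: vc; rewrite inE => /and3P[_ _ /and3P[_ _ /forallP/(_ u)]].
    by rewrite vu su.
  by rewrite (negbTE (cn _ vu uc)).
move: vc; rewrite inE => /and3P[_ _ /and3P[_ sv' _]]; rewrite inE.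
by rewrite (negbTE sv') /= andbF.
Qed.

End Step.

(* cov is the set of nodes already activated, or seen non-activable, in the
   current round: every TOP vertex of N[w] must withdraw or become isolated
   before that round can end. *)
Definition clearing (c : config T) (cov : {set T}) (w : T) : bool :=
  (w \in V 2) && [forall v, cnbhd w v ==> (v \notin Iset c) && (sv c v ==> (v \notin cov))].

(* The round cannot end before w runs Candidacy or a vertex of N[w] becomes
   TOP. *)
Definition pending (c : config T) (cov : {set T}) (w : T) : bool :=
  [&& w \in V 2, w \notin cov & [forall v, cnbhd w v ==> ~~ sv c v]].

Lemma conflict c v : v \in V 1 -> v \notin Iset c -> sv c v -> [exists u, adj v u && sv c u].
Proof.
move=> v1; rewrite inE v1 /= => /nandP[/negbTE->//|/forallPn[u]].
by rewrite negb_imply negbK => uv _; apply/existsP; exists u.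
Qed.

Lemma conflict_withdraw c v : degrees_ok c -> v \in V 1 -> v \notin Iset c -> sv c v ->
  withdraw_en adj c v.
Proof.
move=> ok v1 vI sv'; rewrite /withdraw_en sv' conflict // ok ?eqxx //.
exact: Vset1_notin v1 (cnbhdxx v).
Qed.

Lemma conflict_activable c v : degrees_ok c -> v \in V 1 -> v \notin Iset c -> sv c v ->
  activable c v.
Proof.
by move=> ok v1 vI sv'; rewrite /Defs.activable conflict_withdraw // !orbT.
Qed.

Lemma pending_clearing c cov w : pending c cov w -> clearing c cov w.
Proof.
case/and3P=> w2 _ /forallP wn; rewrite /clearing w2; apply/forallP=> v; apply/implyP=> wv.
have := wn v; rewrite wv /= => sv'; rewrite (negbTE sv') andbT inE (negbTE sv').
by rewrite andbF.
Qed.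

Lemma bot_activable c w : degrees_ok c -> w \in V 2 -> (forall v, cnbhd w v -> ~~ sv c v) ->
  activable c w.
Proof.
move=> ok w2 wn; rewrite /Defs.activable /cand_en ok ?eqxx ?wn ?cnbhdxx //=; last first.
  exact: Vset2_notin w2 (cnbhdxx w).
rewrite (_ : [forall v, _]) ?orbT //; apply/forallP=> v; apply/implyP=> wv.
by apply: wn; rewrite /cnbhd wv orbT.
Qed.

(** I is always independent, so it fails to be maximal: a larger independent set inside the allowed
    vertices provides [w]. TOP vertices of N[w] are in conflict, hence activable and not covered
    when a round starts. *)
Lemma not_good_clearing c : degrees_ok c -> ~~ good adj B c ->
  exists w, clearing c (~: activable_set c) w.
Proof.
move=> ok; rewrite /good /mis_of subsetUr /=.
have -> /= : independent adj (Iset c).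
  apply/forall_inP=> u; rewrite inE => /and3P[_ _ /forallP un]; apply/forall_inP=> v.
  rewrite inE => /and3P[_ sv' _]; apply/negP=> uv.
  by have := un v; rewrite uv sv'.
case/forallPn=> J; rewrite negb_imply negbK => /andP[/andP[/properP[IJ [w wJ wI]] JV]].
move/forall_inP=> ind; exists w.
have w2 : w \in V 2 by have := subsetP JV _ wJ; rewrite in_setU (negbTE wI) orbF.
rewrite /clearing w2; apply/forallP=> v; apply/implyP=> wv.
have vI : v \notin Iset c.
  case/orP: wv => [/eqP->//|wv]; apply/negP=> /(subsetP IJ) vJ.
  by have /forall_inP/(_ _ vJ) := ind _ wJ; rewrite wv.
rewrite vI /=; apply/implyP=> sv'; rewrite !inE negbK.
by apply: conflict_activable => //; apply: Vset_step w2 wv.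
Qed.

(** A full cover leaves no TOP vertex in N[w], so Candidacy is enabled at [w] and the new round
    cannot end without it being dealt with. *)
Lemma clearing_round_end c w : degrees_ok c -> clearing c setT w ->
  pending c (~: activable_set c) w.
Proof.
move=> ok /andP[w2 /forallP wn].
have wb v : cnbhd w v -> ~~ sv c v by have := wn v; rewrite in_setT implybF => /implyP H /H/andP[].
rewrite /pending w2 !inE negbK bot_activable //=.
by apply/forallP=> v; apply/implyP=> /wb.
Qed.

Section Preservation.
Variable h : seq (config T).
Variable coin : {ffun T -> bool}.
Let c := cur h.
Let c' := Defs.next adj B st h coin.
Variables (cov : {set T}) (w : T).
Hypothesis ok : degrees_ok c.
Hypothesis quiet : forall v, cnbhd w v -> v \in cand_set adj B st h -> ~~ coin v.

Let cov' := cov :|: act adj B st h :|: ~: activable_set c'.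

(** With no successful candidacy in N[w], a vertex TOP afterwards was TOP and in conflict before. It
    was not activated, or it would have withdrawn, and it is still in conflict, so it stays
    uncovered. *)
Lemma clearing_next : clearing c cov w -> Iset c' = Iset c -> clearing c' cov' w.
Proof.
case/andP=> w2 /forallP wn eI; rewrite /clearing w2; apply/forallP=> v; apply/implyP=> wv.
have := wn v; rewrite wv eI /= => /andP[vI vcov]; rewrite vI /=; apply/implyP=> sv'.
have v1 := Vset_step _ _ _ w2 wv.
have vB := Vset2_notin _ _ w2 wv.
have [sc|[vc cv]] := next_sv _ _ _ vB sv'; last by have := quiet _ wv vc; rewrite cv.
rewrite sc /= in vcov; rewrite notin_cover vcov /=; apply/andP; split.
  apply/negP=> va; have := next_withdraw _ coin _ vB (conflict_withdraw _ _ ok v1 vI sc) va.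
  by rewrite sv'.
apply: conflict_activable => //; first exact: next_degrees_ok.
by rewrite -/c' eI.
Qed.

Lemma pending_next : w \notin act adj B st h -> pending c cov w -> pending c' cov' w.
Proof.
move=> wa /and3P[w2 wcov /forallP wn].
have wb v : cnbhd w v -> ~~ sv c' v.
  move=> wv; apply/negP=> /(next_sv _ _ _ (Vset2_notin _ _ w2 wv))[sc|[vc]].
    by have := wn v; rewrite wv sc.
  by rewrite (negbTE (quiet _ wv vc)).
rewrite /pending w2 notin_cover wcov wa bot_activable //=.
  by apply/forallP=> v; apply/implyP=> /wb.
exact: next_degrees_ok.
Qed.

Lemma pending_cand : w \in act adj B st h -> pending c cov w -> w \in cand_set adj B st h.
Proof.
move=> wa /and3P[w2 _ /forallP wn]; have wB := Vset2_notin _ _ w2 (cnbhdxx w).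
rewrite inE wa wB /cand_en -/c ok // eqxx /=.
have := wn w; rewrite cnbhdxx /= => -> /=; apply/forallP=> v; apply/implyP=> wv.
by have := wn v; rewrite /cnbhd wv orbT.
Qed.

End Preservation.

End Dynamics.

(** * Rounds and fairness *)

Section Rounds.
Context {R : realType} {T : finType} (adj : rel T) (B : {set T}).
Variable st : strategy T.

Local Notation activable_set := (activable_set adj B).
Local Notation c_dflt := ([ffun=> (false, 0%N)] : config T).

Definition rounds (h : seq (config T)) : nat := (rstate adj B st h (size h).-1).1.
Definition cover (h : seq (config T)) : {set T} := (rstate adj B st h (size h).-1).2.

(** The cover after one more configuration, before the test for the end of the round. *)
Definition new_cover h c := cover h :|: act adj B st h :|: ~: activable_set c.

Lemma rstate_rcons h c i : (i < size h)%N -> rstate adj B st (rcons h c) i = rstate adj B st h i.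
Proof.
elim: i => [|i IHi] ih /=; rewrite nth_rcons ih //.
by rewrite IHi 1?ltnW // -cats1 takel_cat 1?ltnW.
Qed.

Lemma rstate_step h c : h != [::] -> rstate adj B st (rcons h c) (size h) =
  if new_cover h c == setT then ((rounds h).+1, ~: activable_set c) else (rounds h, new_cover h c).
Proof.
rewrite -size_eq0 -lt0n => h0; rewrite -[in LHS](prednK h0) /= prednK //.
rewrite rstate_rcons ?prednK // nth_rcons ltnn eqxx -cats1 takel_cat // take_size.
by rewrite /rounds /new_cover /cover; case: (rstate _ _ _ _ _).
Qed.

Lemma rounds_rcons h c : h != [::] ->
  rounds (rcons h c) = if new_cover h c == setT then (rounds h).+1 else rounds h.
Proof. by move=> h0; rewrite /rounds size_rcons /= rstate_step //; case: ifP. Qed.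

Lemma cover_rcons h c : h != [::] ->
  cover (rcons h c) = if new_cover h c == setT then ~: activable_set c else new_cover h c.
Proof. by move=> h0; rewrite /cover size_rcons /= rstate_step //; case: ifP. Qed.

Lemma rcons_nil (h : seq (config T)) c : rcons h c != [::].
Proof. by case: h. Qed.

Lemma cur_rcons (h : seq (config T)) c : cur (rcons h c) = c.
Proof. by rewrite /cur last_rcons. Qed.

Lemma leq_rounds h c : h != [::] -> (rounds h <= rounds (rcons h c))%N.
Proof. by move=> h0; rewrite rounds_rcons //; case: ifP. Qed.

(** A configuration that closes a round is counted in the round it closes, hence [rounds h] and not
    the updated count. *)
Lemma reached_rcons (K : R) h c : h != [::] ->
  reached_within adj B st K (rcons h c) =
  reached_within adj B st K h || good adj B c && ((rounds h).+1%:R <= K).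
Proof.
move=> h0; have rb j : (j < size h)%N ->
    rounds_before adj B st (rcons h c) j = rounds_before adj B st h j.
  by move=> jh; rewrite /rounds_before rstate_rcons //; apply: leq_ltn_trans jh; apply: leq_pred.
have rbl : rounds_before adj B st (rcons h c) (size h) = rounds h.
  by rewrite /rounds_before rstate_rcons // prednK ?lt0n ?size_eq0.
apply/existsP/orP => [[[j jh] /=]|[/existsP[[j jh] /= Hj]|Hc]].
- rewrite size_rcons ltnS leq_eqVlt in jh; case/orP: (jh) => [/eqP->|jh'].
    by rewrite rbl nth_rcons ltnn eqxx; right.
  by rewrite rb // nth_rcons jh' => Hj; left; apply/existsP; exists (Ordinal jh').
- have jh' : (j < size (rcons h c))%N by rewrite size_rcons ltnW.
  by exists (Ordinal jh') => /=; rewrite rb // nth_rcons jh.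
have jh' : (size h < size (rcons h c))%N by rewrite size_rcons.
by exists (Ordinal jh') => /=; rewrite rbl nth_rcons ltnn eqxx.
Qed.

(** A correct node acquires the right [x] when first activated or first seen non-activable, and
    keeps it; the end of the first round therefore settles all correct nodes. *)
Definition history_ok (h : seq (config T)) : Prop :=
  h != [::] /\ forall u, u \notin B -> (0 < rounds h)%N || (u \in cover h) ->
    xv (cur h) u = deg adj u.

Lemma history_ok1 c : history_ok [:: c].
Proof.
split=> // u uB; rewrite /rounds /cover /= !inE => ua.
exact: not_activable_deg ua.
Qed.

Lemma history_ok_rcons h coin : history_ok h ->
  history_ok (rcons h (Defs.next adj B st h coin)).
Proof.
move=> [h0 ok]; split=> [|u uB]; first exact: rcons_nil.
rewrite cur_rcons rounds_rcons // cover_rcons //; set c' := Defs.next _ _ _ _ _ => H.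
have : (0 < rounds h)%N || (u \in new_cover h c').
  by move: H; case: eqP => [->|//]; rewrite in_setT orbT.
rewrite in_setU in_setU in_setC => /orP[r0|/orP[/orP[ucov|ua]|]].
- by apply: next_deg => //; apply: ok; rewrite ?r0.
- by apply: next_deg => //; apply: ok; rewrite ?ucov ?orbT.
- exact: act_deg.
by rewrite inE => ua; apply: not_activable_deg ua.
Qed.

Lemma hist_rcons (c : nat -> config T) i : hist c i.+1 = rcons (hist c i) (c i.+1).
Proof. by rewrite /hist -[in iota _ _]addn1 iotaD map_cat cats1. Qed.

(** If the count stopped at [m], the cover would only grow. Fairness puts each node into it
    eventually, and at the latest of these finitely many times the round would have ended. *)
Lemma fair_rounds_unbounded c : fair_exec adj B st c ->
  forall m, exists i, (m <= rounds (hist c i))%N.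
Proof.
move=> fair; elim=> [|m [i mi]]; first by exists 0%N.
case: (pselect (exists j, (m < rounds (hist c j))%N)) => // nex.
have h0 j : hist c j != [::] by [].
have rj j : (i <= j)%N -> rounds (hist c j) = m.
  move=> /subnK <-; elim: (j - i)%N => [|k IHk]; apply/eqP; rewrite eqn_leq.
    by rewrite mi andbT leqNgt; apply/negP=> ?; apply: nex; exists i.
  rewrite -{2}IHk addSn hist_rcons leq_rounds // andbT -hist_rcons.
  by rewrite leqNgt; apply/negP=> ?; apply: nex; exists (k + i).+1.
have covS j : (i <= j)%N -> cover (hist c j.+1) = new_cover (hist c j) (c j.+1)
    /\ new_cover (hist c j) (c j.+1) <> setT.
  move=> ij; have := rj _ (leqW ij); rewrite hist_rcons rounds_rcons // cover_rcons //.
  by rewrite rj //; case: eqP => // _ /eqP; rewrite gtn_eqF.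
have cov_mono j k u : (i <= j)%N -> u \in cover (hist c j) -> u \in cover (hist c (k + j)).
  move=> ij uj; elim: k => // k IHk; rewrite addSn.
  have [-> _] := covS (k + j)%N (leq_trans ij (leq_addl _ _)).
  by rewrite !in_setU IHk.
have evcov u : exists j, (i <= j)%N /\ u \in cover (hist c j).
  case: (pselect (exists j, (i <= j)%N /\ u \in cover (hist c j))) => // nu.
  exfalso; apply: (fair u); exists i.+1 => -[//|j] ij.
  apply/andP; apply: contraT; rewrite negb_and negbK => /orP[na|ua].
    exfalso; apply: nu; exists j.+1; split; first exact: ltnW.
    have [-> _] := covS j ij.
    by rewrite in_setU in_setC [u \in activable_set _]inE na orbT.
  exfalso; apply: nu; exists j.+2; split; first by rewrite leqW // ltnW.
  have [-> _] := covS j.+1 (ltnW ij).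
  by rewrite !in_setU ua orbT.
have [f fP] := choice evcov.
pose J := \max_u f u.
have [] := covS (J + i)%N (leq_addl _ _) => _; case.
apply/setP=> u; rewrite in_setT !in_setU.
have [iu uc] := fP u.
have uJ : (f u <= J + i)%N by apply: leq_trans (leq_addr _ _); apply: leq_bigmax.
by rewrite -(subnK uJ) cov_mono.
Qed.

Fixpoint all_reach (m k : nat) (h : seq (config T)) : Prop :=
  if k is k'.+1 then forall coin, 0 < weight R adj B st h coin ->
    all_reach m k' (rcons h (Defs.next adj B st h coin))
  else (m <= rounds h)%N.

Lemma all_reach_le m k k' h : h != [::] -> (k <= k')%N -> all_reach m k h -> all_reach m k' h.
Proof.
move=> h0 /subnK <-; move: (k' - k)%N => d; elim: k h h0 => [|k IHk] h h0 /=.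
  rewrite addn0; elim: d h h0 => // d IHd h h0 mh coin _.
  by apply: IHd; [apply: rcons_nil|apply: leq_trans mh (leq_rounds _ _ h0)].
by rewrite addnS => H coin w0; apply: IHk; [apply: rcons_nil|apply: H].
Qed.

(** Otherwise every outcome of positive weight has its own bound, and the maximum over the finitely
    many outcomes, plus one, serves [h]. *)
Lemma stuck_extend m h : h != [::] -> (forall k, ~ all_reach m k h) ->
  exists coin, 0 < weight R adj B st h coin /\
    forall k, ~ all_reach m k (rcons h (Defs.next adj B st h coin)).
Proof.
move=> h0 nk; case: (pselect (exists coin, 0 < weight R adj B st h coin /\
    forall k, ~ all_reach m k (rcons h (Defs.next adj B st h coin)))) => // nex.
have ex coin : exists k, 0 < weight R adj B st h coin ->
    all_reach m k (rcons h (Defs.next adj B st h coin)).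
  case: (pselect (0 < weight R adj B st h coin)) => [w0|nw]; last by exists 0%N.
  case: (pselect (exists k, all_reach m k (rcons h (Defs.next adj B st h coin)))).
    by move=> [k Hk]; exists k.
  move=> nk'; exfalso; apply: nex; exists coin; split=> // k Hk; apply: nk'.
  by exists k.
have [f fP] := choice ex.
case: (nk (\max_coin f coin).+1) => coin w0 /=.
by apply: (@all_reach_le _ (f coin)); [apply: rcons_nil|apply: leq_bigmax|apply: fP].
Qed.

(* Koenig's lemma: there are finitely many coin outcomes at each step, so if no
   k worked there would be an infinite possible execution with fewer than m
   rounds, against fairness. *)
Lemma fair_all_reach m c0 : fair_strategy R adj B st c0 ->
  exists k, all_reach m k [:: c0].
Proof.
move=> fair; case: (pselect (exists k, all_reach m k [:: c0])) => // nk.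
pose stuck h := h != [::] /\ forall k, ~ all_reach m k h.
have ex h : exists coin, stuck h -> 0 < weight R adj B st h coin /\
    stuck (rcons h (Defs.next adj B st h coin)).
  case: (pselect (stuck h)) => [[h0 sh]|]; last by exists [ffun=> false].
  have [coin [w0 H]] := stuck_extend m h h0 sh; exists coin => _; split=> //.
  by split=> //; apply: rcons_nil.
have [f fP] := choice ex.
pose H i := iter i (fun h => rcons h (Defs.next adj B st h (f h))) [:: c0].
have HS i : stuck (H i).
  elim: i => [|i IHi]; first by split=> // k Hk; apply: nk; exists k.
  by have [] := fP _ IHi.
pose c i := cur (H i).
have hc i : hist c i = H i.
  by elim: i => // i IHi; rewrite hist_rcons IHi /c /= cur_rcons.
have /fair/fair_rounds_unbounded/(_ m)[i mi] : possible_exec R adj B st c0 c.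
  split=> // i; exists (f (H i)); rewrite hc; split; first by have [] := fP _ (HS i).
  by rewrite /c /= cur_rcons.
by have [_ /(_ 0%N)] := HS i; rewrite /= -hc.
Qed.

End Rounds.

(** * The potential is a supermartingale *)

Section Potential.
Context {R : realType} {T : finType} (adj : rel T) (B : {set T}).
Hypotheses (adj_sym : symmetric adj) (adj_irr : irreflexive adj).
Variable st : strategy T.
(** [K] will be $1+M$ and [N] the integer part of $M$, so [N.+1] rounds are allowed. *)
Variables (K : R) (N : nat).
Hypothesis KN : forall r : nat, (r.+1%:R <= K) = (r <= N)%N.

Local Notation D := (maxdeg adj).
Local Notation g := (growth D : R).
Local Notation y := (inve : R).
Local Notation Iset := (Iset adj B).
Local Notation activable_set := (activable_set adj B).
Local Notation rounds := (rounds adj B st).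
Local Notation cover := (cover adj B st).
Local Notation new_cover := (new_cover adj B st).
Local Notation pending := (pending adj B).
Local Notation clearing := (clearing adj B).
Local Notation next := (Defs.next adj B st).
Local Notation reached := (reached_within adj B st K).
Local Notation cands := (cand_set adj B st).

(** The exponent of $g$ is the number of round ends that may pass before some vertex is pending: at
    a round end a configuration that is not good is clearing, and a clearing vertex becomes
    pending. *)
Definition stage (c : config T) (cov : {set T}) : R :=
  if [exists w, pending c cov w] then 1
  else if [exists w, clearing c cov w] then g else g ^+ 2.

Definition deficit (c : config T) : R := expR (#|T|%:R - 1 - #|Iset c|%:R).

(* Frozen once N+1 rounds have ended: a good configuration occurring later no
   longer counts. The first round only serves to correct the variables x. *)
Definition potential (h : seq (config T)) : R :=
  if reached h then 0
  else if (N < rounds h)%N then g ^+ N.+1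
  else if rounds h == 0%N then expR (#|T|%:R - 1) * g ^+ 2
  else deficit (cur h) * g ^+ rounds h * stage (cur h) (cover h).

Let g1 : 1 <= g := growth_ge1 D.
Let g0 : 0 <= g := growth_ge0 D.
Let y0 : 0 <= y := ltW inve_gt0.

Lemma g_le_g2 : g <= g ^+ 2.
Proof. by rewrite expr2 ler_peMl. Qed.

Lemma g2_ge1 : 1 <= g ^+ 2.
Proof. by rewrite exprn_ege1. Qed.

Lemma stage_ge1 c cov : 1 <= stage c cov.
Proof. by rewrite /stage; case: ifP => // _; case: ifP => _ //; apply: g2_ge1. Qed.

Lemma stage_le c cov : stage c cov <= g ^+ 2.
Proof.
rewrite /stage; case: ifP => _; first exact: g2_ge1.
by case: ifP => // _; apply: g_le_g2.
Qed.

Lemma stage_clearing c cov w : clearing c cov w -> stage c cov <= g.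
Proof.
move=> cw; rewrite /stage; case: ifP => // _.
by have -> : [exists w, clearing c cov w] by apply/existsP; exists w.
Qed.

Lemma stage_pending c cov w : pending c cov w -> stage c cov = 1.
Proof. by move=> cw; rewrite /stage; have -> : [exists w, pending c cov w] by apply/existsP; exists w. Qed.

Lemma deficit_ge0 c : 0 <= deficit c. Proof. exact: expR_ge0. Qed.

Lemma deficit_le c : deficit c <= expR (#|T|%:R - 1).
Proof. by rewrite ler_expR gerBl ler0n. Qed.

Lemma deficit_ge1 c cov w : clearing c cov w -> 1 <= deficit c.
Proof.
case/andP=> _ /forallP/(_ w); rewrite cnbhdxx /= => /andP[wI _].
have : (#|Iset c| < #|T|)%N.
  by rewrite -cardsT; apply: proper_card; rewrite properT; apply: contraNneq wI => ->.
rewrite -(ler_nat R) -natr1 => lt_I; rewrite /deficit -[leLHS]expR0 ler_expR; lra.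
Qed.

Lemma deficit_sub c c' : Iset c \subset Iset c' -> deficit c' <= deficit c.
Proof. by move=> /subset_leq_card s; rewrite ler_expR lerD2l lerN2 ler_nat. Qed.

Lemma deficit_proper c c' : Iset c \proper Iset c' -> deficit c' <= deficit c * y.
Proof.
move=> /proper_card s; rewrite /deficit /inve -expRN -expRD ler_expR.
by rewrite -[leRHS]addrA -opprD natr1 lerD2l lerN2 ler_nat.
Qed.

Lemma potential_ge0 h : 0 <= potential h.
Proof.
rewrite /potential; case: ifP => // _; case: ifP => _; first exact: exprn_ge0.
case: ifP => _; first by rewrite mulr_ge0 ?expR_ge0 ?exprn_ge0.
by rewrite !mulr_ge0 ?deficit_ge0 ?exprn_ge0 // (le_trans _ (stage_ge1 _ _)).
Qed.

Section Step.
Variable h : seq (config T).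
Hypothesis hok : history_ok adj B st h.
Hypothesis rN : (rounds h <= N)%N.
Hypothesis nreach : ~~ reached h.
Let h0 : h != [::] := hok.1.
Let c := cur h.

Lemma not_reached_next coin : ~~ reached (rcons h (next h coin)) ->
  ~~ good adj B (next h coin).
Proof. by rewrite reached_rcons // (negbTE nreach) /= KN rN andbT. Qed.

Lemma round_end_degrees coin : new_cover h (next h coin) == setT ->
  degrees_ok adj B (next h coin).
Proof.
move=> full u uB; have [_] := history_ok_rcons adj B st h coin hok.
by rewrite cur_rcons; apply=> //; rewrite rounds_rcons // full.
Qed.

Lemma potential_next coin (c' := next h coin) :
  (0 < rounds h)%N || (new_cover h c' == setT) ->
  potential (rcons h c') <= deficit c' * g ^+ rounds h *
    (if new_cover h c' == setT then g * stage c' (~: activable_set c')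
     else stage c' (new_cover h c')).
Proof.
move=> Hr; have s0 cov : 0 <= stage c' cov by rewrite (le_trans _ (stage_ge1 _ _)).
rewrite /potential; case: (boolP (reached _)) => [_|nr].
  by rewrite !mulr_ge0 ?deficit_ge0 ?exprn_ge0 //; case: ifP; rewrite ?mulr_ge0.
rewrite rounds_rcons // cover_rcons // cur_rcons.
case: (boolP (new_cover h c' == setT)) Hr => [full _|_]; last first.
  by rewrite orbF lt0n => /negbTE r0; rewrite ltnNge rN r0.
have [w cw] := not_good_clearing adj B _ (round_end_degrees _ full) (not_reached_next _ nr).
rewrite mulrA -[_ * _ * g]mulrA -exprSr ltnS /=; case: ifPn => // Nr.
have -> : N.+1 = (rounds h).+1 by congr _.+1; apply/eqP; rewrite eqn_leq Nr rN.
rewrite -[leLHS]mul1r -[leLHS]mulr1; apply: ler_pM; rewrite ?mul1r ?exprn_ge0 ?stage_ge1 //.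
by rewrite ler_peMl ?exprn_ge0 // (deficit_ge1 _ _ _ cw).
Qed.

Lemma potential_next_le coin (c' := next h coin) : (0 < rounds h)%N ->
  potential (rcons h c') <= deficit c' * g ^+ rounds h * g ^+ 2.
Proof.
move=> r0; case: (boolP (reached (rcons h c'))) => [rc|nr].
  rewrite /potential rc.
  exact: mulr_ge0 (mulr_ge0 (deficit_ge0 _) (exprn_ge0 _ g0)) (exprn_ge0 _ g0).
apply: (le_trans (potential_next coin _)); first by rewrite r0.
rewrite ler_wpM2l ?mulr_ge0 ?deficit_ge0 ?exprn_ge0 // -/c'.
case: ifPn => [full|_]; last exact: stage_le.
have [w cw] := not_good_clearing adj B _ (round_end_degrees _ full) (not_reached_next _ nr).
by rewrite expr2 ler_wpM2l // (stage_clearing _ _ _ cw).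
Qed.

Lemma potential_next_sub coin : (0 < rounds h)%N ->
  potential (rcons h (next h coin)) <= deficit c * g ^+ rounds h * g ^+ 2.
Proof.
move=> r0; apply: (le_trans (potential_next_le _ r0)).
rewrite !ler_wpM2r ?exprn_ge0 // deficit_sub //.
exact: Iset_next_sub.
Qed.

Lemma potential_next_proper coin : (0 < rounds h)%N -> Iset c \proper Iset (next h coin) ->
  potential (rcons h (next h coin)) <= deficit c * g ^+ rounds h * (g ^+ 2 * y).
Proof.
move=> r0 cc'; apply: (le_trans (potential_next_le _ r0)).
rewrite mulrA [_ * y]mulrC !mulrA !ler_wpM2r ?exprn_ge0 // mulrC.
exact: deficit_proper.
Qed.

Lemma degrees_ok_cur : (0 < rounds h)%N -> degrees_ok adj B c.
Proof. by move=> r0 u uB; apply: hok.2 => //; rewrite r0. Qed.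

Let X := deficit c * g ^+ rounds h.
Let X0 : 0 <= X. Proof. by rewrite mulr_ge0 ?deficit_ge0 ?exprn_ge0. Qed.

(** When I grows, the factor $1/e$ outweighs a reset of the stage from $g$ to $g^2$. *)
Lemma g2y_le : g ^+ 2 * y <= g.
Proof.
rewrite expr2 -mulrA ler_piMr //; apply: le_trans (growth_fail_le1 D).
by rewrite ler_wpM2l // inve_le_fail_factor.
Qed.

Lemma potential_next_clearing (coin : {ffun T -> bool}) w : (0 < rounds h)%N -> clearing c (cover h) w ->
  (forall v, cnbhd adj w v -> v \in cands h -> ~~ coin v) ->
  potential (rcons h (next h coin)) <= X * g.
Proof.
move=> r0 cw quiet; have ok := degrees_ok_cur r0.
have sI := Iset_next_sub adj B adj_sym st h coin.
(* I may grow elsewhere in the graph. If it does not, [w] stays clearing, and a round end costs a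
   factor $g$ but makes [w] pending. *)
case: (boolP (Iset c \proper Iset (next h coin))) => [pI|].
  by apply: (le_trans (potential_next_proper _ r0 pI)); rewrite ler_wpM2l // g2y_le.
rewrite properEneq sI andbT negbK => /eqP eI.
have cw' := clearing_next adj B st h coin (cover h) w ok quiet cw (esym eI).
apply: (le_trans (potential_next coin _)); first by rewrite r0.
apply: ler_pM; rewrite ?mulr_ge0 ?deficit_ge0 ?exprn_ge0 //.
- by case: ifP => _; rewrite ?mulr_ge0 // (le_trans _ (stage_ge1 _ _)).
- by rewrite ler_wpM2r ?exprn_ge0 // deficit_sub.
case: ifPn => [full|_]; last exact: stage_clearing cw'.
rewrite -/(new_cover _ _) (eqP full) in cw'.
rewrite (stage_pending _ _ w) ?mulr1 //.
by apply: clearing_round_end cw'; apply: next_degrees_ok.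
Qed.

(** As [w] remains uncovered, this transition cannot end the round. *)
Lemma potential_next_pending (coin : {ffun T -> bool}) w : (0 < rounds h)%N -> pending c (cover h) w ->
  (forall v, cnbhd adj w v -> v \in cands h -> ~~ coin v) -> w \notin act adj B st h ->
  potential (rcons h (next h coin)) <= X.
Proof.
move=> r0 cw quiet wa; have ok := degrees_ok_cur r0.
have cw' := pending_next adj B st h coin (cover h) w ok quiet wa cw.
apply: (le_trans (potential_next coin _)); first by rewrite r0.
rewrite ifN; last first.
  by apply/negP=> /eqP full; move: cw'; rewrite -/(new_cover _ _) full => /and3P[_]; rewrite in_setT.
rewrite (stage_pending _ _ _ cw') mulr1 ler_wpM2r ?exprn_ge0 // deficit_sub //.
exact: Iset_next_sub.
Qed.

Definition coin_prob (u : T) : R := if u \in cands h then qprob R adj c u else 0.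

Lemma weight_bern coin : weight R adj B st h coin = bern coin_prob coin.
Proof.
apply: eq_bigr => u _; rewrite /coin_prob -/c.
by case: ifP => // _; rewrite subr0.
Qed.

Lemma coin_prob01 u : 0 <= coin_prob u <= 1.
Proof.
rewrite /coin_prob; case: ifP => _; last by rewrite lexx ler01.
rewrite /qprob div1r invr_ge0 addr_ge0 ?ler0n //= invf_le1 ?lerDl ?ler0n //.
by rewrite ltr_wpDr ?ler0n.
Qed.

Lemma cnbhd_sym u v : cnbhd adj u v = cnbhd adj v u.
Proof. by rewrite /cnbhd eq_sym adj_sym. Qed.

Lemma coin_prob_ge w : (0 < rounds h)%N -> w \in Vset adj B 2 -> w \in cands h ->
  coin_min D <= coin_prob w.
Proof.
move=> r0 w2 wc; rewrite /coin_prob wc /qprob div1r /coin_min lef_pV2 ?posrE ?ltr0n //; last first.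
  by rewrite ltr_wpDr ?ler0n.
rewrite addrC natr1 ler_nat ltnS; apply/bigmax_leqP => v wv.
rewrite (degrees_ok_cur r0); first exact: leq_bigmax.
exact: Vset2_notin w2 wv.
Qed.

(** The maximum in the Candidacy rule of [u] includes $x_v=\deg(v)$, whatever Byzantine nodes write
    near [u]. *)
Lemma coin_prob_le u v : (0 < rounds h)%N -> v \notin B -> cnbhd adj u v ->
  coin_prob u <= (deg adj v).+1%:R^-1.
Proof.
move=> r0 vB uv; rewrite /coin_prob; case: ifP => _; last by rewrite invr_ge0 ler0n.
rewrite /qprob div1r lef_pV2 ?posrE ?ltr0n //; last by rewrite ltr_wpDr ?ler0n.
rewrite addrC natr1 ler_nat ltnS -(degrees_ok_cur r0 _ vB).
exact: (@leq_bigmax_cond _ (cnbhd adj u) (xv c) v uv).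
Qed.

Lemma prod_nbhd_ge v : (0 < rounds h)%N -> v \notin B ->
  iso_prob D <= \prod_(u in nbhd adj v) (1 - coin_prob u).
Proof.
move=> r0 vB; have dD : (deg adj v <= D)%N by apply: leq_bigmax.
apply: (le_trans (iso_prob_le D _ dD)); rewrite /deg -prodr_const.
apply: ler_prod => u; rewrite inE => vu.
rewrite subr_ge0 invf_le1 ?ltr0n // ler1n /= lerD2l lerN2.
by apply: coin_prob_le => //; rewrite cnbhd_sym /cnbhd vu orbT.
Qed.

(** [t] is the probability of a successful candidacy in N[w]. Without one the factor is at most [a];
    with one it is at most $g^2$, and $g^2/e$ if some success is isolated. *)
Lemma potential_expect_clearing w a : (0 < rounds h)%N -> clearing c (cover h) w ->
  (forall coin : {ffun T -> bool},
    (forall v, cnbhd adj w v -> v \in cands h -> ~~ coin v) ->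
    potential (rcons h (next h coin)) <= X * a) ->
  let t := Pr coin_prob (fun coin => [exists v in [set v in cands h | cnbhd adj w v], coin v]) in
  \sum_coin bern coin_prob coin * potential (rcons h (next h coin)) <=
  X * ((1 - t) * a + t * (g ^+ 2 * fail_factor D)).
Proof.
move=> r0 cw quietP; set S := [set v in _ | _] => /=; set t := Pr _ _.
have w2 : w \in Vset adj B 2 by case/andP: cw.
have SV v : v \in S -> v \in Vset adj B 1 /\ v \in cands h.
  by rewrite inE => /andP[vc wv]; split=> //; apply: Vset_step w2 wv.
have -> : X * ((1 - t) * a + t * (g ^+ 2 * fail_factor D)) =
    (1 - t) * (X * a) + t * (X * g ^+ 2 - iso_prob D * (X * g ^+ 2 - X * (g ^+ 2 * y))).
  by rewrite /fail_factor; ring.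
apply: (@bern_expect_le _ _ _ coin_prob01 _ _
  (fun coin => [exists v in S, coin v && none_on (nbhd adj v) coin])).
- move=> coin /exists_inP[v vS /andP[cv _]]; by apply/exists_inP; exists v.
- apply: Pr_isolated => [||v /SV[v1 vc]]; first exact: coin_prob01.
    by have /andP[] := @iso_prob01 R D.
  split; first by rewrite inE adj_irr.
  by apply: prod_nbhd_ge => //; apply: Vset1_notin v1 (cnbhdxx _ _).
- by rewrite ler_wpM2l // (le_trans g2y_le) // g_le_g2.
- move=> coin /exists_inP[v /SV[v1 vc] /andP[cv /forall_inP nv]].
  apply: potential_next_proper => //; apply: (Iset_next_isolated _ _ adj_sym _ _ _ v) => //.
  by move=> u vu _; apply: nv; rewrite inE.
- by move=> coin _; apply: potential_next_sub.
move=> coin /exists_inPn nS; apply: quietP => v wv vc.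
by apply: nS; rewrite inE vc.
Qed.

Lemma potential_expect_active : (0 < rounds h)%N ->
  \sum_coin bern coin_prob coin * potential (rcons h (next h coin)) <=
  X * stage c (cover h).
Proof.
move=> r0; have ok := degrees_ok_cur r0.
have t1 := Pr_le1 _ coin_prob01; have t0 := Pr_ge0 _ coin_prob01.
have s1 := @growth_fail_le1 R D; have s2 := @growth2_fail_le1 R D.
rewrite /stage; case: ifPn => [/existsP[w pw]|_]; last first.
  case: ifPn => [/existsP[w cw]|_]; last first.
    rewrite -[leRHS]mul1r -[X in _ <= X * _](bern_sum1 coin_prob) mulr_suml.
    apply: ler_sum => coin _; rewrite ler_wpM2l ?(bern_ge0 _ coin_prob01) //.
    exact: potential_next_sub.
  apply: (le_trans (potential_expect_clearing w g r0 cw _)).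
    by move=> coin; apply: potential_next_clearing.
  rewrite ler_wpM2l //; set t := Pr _ _; have t1' : t <= 1 := t1 _; have t0' : 0 <= t := t0 _.
  rewrite expr2 -mulrA; move: t t0' t1' => t t0' t1'.
  have : g * (g * fail_factor D) <= g by rewrite -[leRHS]mulr1 ler_wpM2l.
  by move: g (g * _) => a b; nra.
have cw := pending_clearing _ _ _ _ _ pw.
(* If [w] is activated it runs Candidacy, and its success probability pays for a possible round end;
   if not, the round goes on. *)
case: (boolP (w \in act adj B st h)) => wa.
  apply: (le_trans (potential_expect_clearing w g r0 cw _)).
    by move=> coin; apply: potential_next_clearing.
  rewrite ler_wpM2l //; set t := Pr _ _.
  have wc := pending_cand _ _ _ _ _ _ ok wa pw.
  have tq : coin_min D <= t.
    apply: (le_trans (coin_prob_ge _ r0 _ wc)); first by case/and3P: pw.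
    rewrite -(Pr_true coin_prob w); apply: (le_Pr _ coin_prob01) => coin cw'.
    by apply/exists_inP; exists w => //; rewrite inE wc cnbhdxx.
  by have := growth_step_le1 D t tq; rewrite expr2; lra.
apply: (le_trans (potential_expect_clearing w 1 r0 cw _)).
  by move=> coin quiet; rewrite mulr1; apply: (potential_next_pending _ _ r0 pw quiet wa).
rewrite ler_wpM2l //; set t := Pr _ _; have t1' : t <= 1 := t1 _; have t0' : 0 <= t := t0 _.
by move: s2; rewrite expr2 mulrA; move: t t0' t1' (g * g * _) => t t0' t1' b; nra.
Qed.

End Step.

Lemma potential_expect h : history_ok adj B st h ->
  \sum_coin weight R adj B st h coin * potential (rcons h (next h coin)) <= potential h.
Proof.
move=> hok; have h0 := hok.1.
rewrite (eq_bigr (fun coin => bern (coin_prob h) coin * potential (rcons h (next h coin)))); last first.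
  by move=> coin _; rewrite weight_bern.
have constP (z : R) : (forall coin, potential (rcons h (next h coin)) <= z) ->
    \sum_coin bern (coin_prob h) coin * potential (rcons h (next h coin)) <= z.
  move=> H; rewrite -[leRHS]mul1r -[X in _ <= X * _](bern_sum1 (coin_prob h)) mulr_suml.
  by apply: ler_sum => coin _; rewrite ler_wpM2l ?(bern_ge0 _ (coin_prob01 h)).
rewrite {2}/potential; case: (boolP (reached h)) => [rh|nr].
  by apply: constP => coin; rewrite /potential reached_rcons // rh.
case: ltnP => [Nr|rN].
  apply: constP => coin; rewrite /potential; case: ifP => _; first exact: exprn_ge0.
  by rewrite (leq_trans Nr) // leq_rounds.
case: ifPn => [/eqP r0|]; last by rewrite -lt0n => r0; apply: potential_expect_active.
(* During the first round the potential is constant; when that round ends in a configuration that is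
   not good, a clearing vertex bounds the new value by the same constant. *)
apply: constP => coin; set c' := next h coin.
case: (boolP (reached (rcons h c'))) => [rc|nrc].
  by rewrite /potential rc mulr_ge0 ?expR_ge0 ?exprn_ge0.
case: (boolP (new_cover h c' == setT)) => [full|nf]; last first.
  rewrite /potential (negbTE nrc) rounds_rcons // (negbTE nf) r0 ltn0 eqxx //.
have [w cw] := not_good_clearing adj B _ (round_end_degrees _ hok _ full)
  (not_reached_next _ hok rN nr _ nrc).
apply: (le_trans (potential_next _ hok rN nr _ _)); first by rewrite -/c' full orbT.
rewrite -/c' full r0 expr0 mulr1 expr2; apply: ler_pM.
- exact: deficit_ge0.
- by rewrite mulr_ge0 // (le_trans _ (stage_ge1 _ _)).
- exact: deficit_le.
by rewrite ler_wpM2l // (stage_clearing _ _ _ cw).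
Qed.

(** Markov's inequality by induction on [k]: after [k] transitions more than [N] rounds have ended,
    so on failure the potential equals $g^{N+1}$. *)
Lemma prob_reached_ge k h : history_ok adj B st h -> all_reach (R := R) adj B st N.+1 k h ->
  1 - potential h / g ^+ N.+1 <= prob R adj B st k reached h.
Proof.
have G0 : 0 < g ^+ N.+1 by rewrite exprn_gt0 // growth_gt0.
elim: k h => [|k IHk] h hok /= Hr.
  case: (boolP (reached h)) => [_|nr]; first by rewrite gerBl divr_ge0 ?potential_ge0 ?ltW.
  by rewrite /potential (negbTE nr) Hr divff ?subrr // lt0r_neq0.
have le_h : potential h / g ^+ N.+1 >=
    \sum_coin weight R adj B st h coin * (potential (rcons h (next h coin)) / g ^+ N.+1).
  rewrite (eq_bigr (fun coin => weight R adj B st h coin * potential (rcons h (next h coin)) / g ^+ N.+1)).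
    by rewrite -mulr_suml ler_wpM2r ?invr_ge0 ?(ltW G0) // potential_expect.
  by move=> coin _; rewrite mulrA.
have w1 : \sum_coin weight R adj B st h coin = 1.
  by rewrite -(bern_sum1 (coin_prob h)); apply: eq_bigr => coin _; rewrite weight_bern.
rewrite -[X in X - _]w1; apply: (@le_trans _ _ (\sum_coin weight R adj B st h coin *
    (1 - potential (rcons h (next h coin)) / g ^+ N.+1))).
  rewrite (eq_bigr _ (fun coin _ => mulrBr _ _ _)) sumrB lerB //.
  by apply: ler_sum => coin _; rewrite mulr1.
apply: ler_sum => coin _; have w0 : 0 <= weight R adj B st h coin.
  by rewrite weight_bern bern_ge0 // => u; apply: coin_prob01.
(* [all_reach] only speaks of outcomes of positive weight; the others contribute 0 to both sides. *)
have [->|wn] := eqVneq (weight R adj B st h coin) 0; first by rewrite !mul0r.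
rewrite ler_wpM2l //; apply: IHk; first exact: history_ok_rcons.
by apply: Hr; rewrite lt0r wn.
Qed.

End Potential.

(* For every fair strategy (daemon + Byzantine behaviour), the probability
   that the execution reaches, within round_bound p rounds, a configuration
   gamma' with I_gamma' a maximal independent set of G[V_2 u I_gamma'] is at
   least 1 - p.  That probability is the limit (supremum) over k of the
   probability that this has happened within the first k transitions. *)
Theorem mainTheorem1 (R : realType) (T : finType) (adj : rel T) (B : {set T})
    (adj_sym : symmetric adj) (adj_irr : irreflexive adj)
    (p : R) (hp0 : 0 < p) (hp1 : p < 1)
    (c0 : config T) (st : strategy T)
    (hfair : fair_strategy R adj B st c0) :
  forall eps : R, 0 < eps -> exists k : nat,
    1 - p - eps <= prob R adj B st k (reached_within adj B st (round_bound adj p)) [:: c0].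
Proof.
move=> eps eps0.
pose M : R := Num.max (- (alpha R adj ^-2) * ln p)
  (Num.sqrt 2 / (Num.sqrt 2 - 1) * (#|T|%:R / alpha R adj)).
have aE : alpha R adj = rate (maxdeg adj).
  by rewrite /alpha /rate /coin_min /inve div1r invfM.
have M0 : 0 <= M.
  rewrite le_max; apply/orP; left; rewrite mulNr -mulrN mulr_ge0 //.
    by rewrite invr_ge0 exprn_ge0 // aE ltW // rate_gt0.
  by rewrite oppr_ge0 ln_le0 // ltW.
pose N := Num.truncn M.
have KN (r : nat) : (r.+1%:R <= round_bound adj p) = (r <= N)%N.
  by rewrite /round_bound -/M -natr1 addrC lerD2l truncn_ge_nat.
have [k Hk] := fair_all_reach adj B st N.+1 c0 hfair.
exists k; have := prob_reached_ge adj B adj_sym adj_irr st _ _ KN k _ (history_ok1 adj B st c0) Hk.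
apply: le_trans; rewrite -addrA lerD2l -opprD lerN2.
apply: (@le_trans _ _ p); last by rewrite lerDl ltW.
have G0 : 0 < growth (maxdeg adj) ^+ N.+1 :> R by rewrite exprn_gt0 // growth_gt0.
(* No round has ended in [[:: c0]], so its potential is 0 or the first-round constant. *)
rewrite ler_pdivrMr // /potential; case: ifP => _; first by rewrite mulr_ge0 // ltW.
apply: final_bound => //.
  by rewrite -aE /M le_max lexx.
by rewrite -aE /M le_max lexx orbT.
Qed.
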